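(* Let $k$ and $\ell$ be positive integers such that $k+\ell\ge 3$, and let $D$ be a Hamiltonian digraph containing no 2-block cycle $c(k,\ell)$. Then $D$ is $(k+\ell-1)$-degenerate, which implies that $\chi(D)\le k+\ell$.
   Context: All graphs and digraphs are finite and simple: no loops and no multiple edges/arcs, but in a digraph a pair of opposite arcs $(u,v),(v,u)$ is allowed. Paths and cycles in a digraph are always directed; the length of a path is its number of arcs. A digraph is Hamiltonian if it contains a (directed) cycle passing through all its vertices. The underlying graph of $D$ is the simple graph obtained by ignoring directions of arcs, and $\chi(D)$ is the chromatic number of the underlying graph. A graph $G$ is $d$-degenerate if every (nonempty) subgraph of $G$ contains a vertex having at most $d$ neighbors in it; a digraph is $d$-degenerate if its underlying graph is. For positive integers $k,\ell$, a 2-block cycle $c(k,\ell)$ is an orientation of an undirected cycle which consists of two internally vertex-disjoint directed paths, of lengths at least $k$ and at least $\ell$ respectively, from one vertex to another vertex. ''$D$ contains no $c(k,\ell)$'' means no subdigraph of $D$ is of this form. *)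

(* Defs.v *)
From mathcomp Require Import all_boot.

Set Implicit Arguments.
Unset Strict Implicit.
Unset Printing Implicit Defensive.

Record sgraph := SGraph {
  svertex :> finType;
  edge : rel svertex;
  edge_sym : symmetric edge;
  edge_irr : irreflexive edge }.

(* [arc] need not be antisymmetric: opposite arcs are allowed. *)
Record digraph := Digraph {
  dvertex :> finType;
  arc : rel dvertex;
  arc_irr : irreflexive arc }.

Section Underlying.
Variable D : digraph.

Definition uedge : rel D := fun x y => arc x y || arc y x.

Lemma uedge_sym : symmetric uedge.
Proof. by move=> x y; rewrite /uedge orbC. Qed.

Lemma uedge_irr : irreflexive uedge.
Proof. by move=> x; rewrite /uedge arc_irr. Qed.

Definition underlying : sgraph := SGraph uedge_sym uedge_irr.

End Underlying.

(* The bound on the size excludes the empty sequence, which satisfies [ucycle];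
   two opposite arcs do form a directed cycle (of length 2). *)
Definition hamiltonian (D : digraph) : Prop :=
  exists c : seq D, [/\ 1 < size c, ucycle (@arc D) c & forall v, v \in c].

(* [p] lists the internal vertices of a path from [x] to [y], whose length is
   therefore [(size p).+1]; [uniq] also forces [x] and [y] to be distinct. *)
Definition dipath (D : digraph) (x : D) (p : seq D) (y : D) : bool :=
  path (@arc D) x (rcons p y) && uniq (x :: rcons p y).

(* The last condition says that the two paths are not one and the same arc, so
   that their union is indeed an orientation of a cycle; it matters only for
   k = l = 1. *)
Definition has_two_block_cycle (D : digraph) (k l : nat) : Prop :=
  exists (x y : D) (p q : seq D),
    [/\ dipath x p y /\ dipath x q y,
        [disjoint p & q],
        k <= (size p).+1,
        l <= (size q).+1
      & 0 < size p + size q].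

Definition is_subgraph (G : sgraph) (S : {set G}) (H : rel G) : Prop :=
  symmetric H /\ forall x y, H x y -> [&& x \in S, y \in S & edge x y].

Definition degenerate (d : nat) (G : sgraph) : Prop :=
  forall (S : {set G}) (H : rel G), is_subgraph S H -> S != set0 ->
  exists2 v, v \in S & #|[set w | H v w]| <= d.

Definition colorable (G : sgraph) (n : nat) : bool :=
  [exists f : {ffun G -> 'I_n}, [forall x, forall y, edge x y ==> (f x != f y)]].

Lemma ex_colorable (G : sgraph) : exists n, colorable G n.
Proof.
exists #|G|; apply/existsP; exists [ffun x => enum_rank x].
apply/forallP=> x; apply/forallP=> y; apply/implyP=> exy; rewrite !ffunE.
by apply: contraTneq exy => /enum_rank_inj ->; rewrite edge_irr.
Qed.

Definition chromatic_number (G : sgraph) : nat := ex_minn (ex_colorable G).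

(* Main.v *)
From mathcomp Require Import all_boot zify.
Require Import Defs.

Set Implicit Arguments.
Unset Strict Implicit.
Unset Printing Implicit Defensive.

(** Why the theorem holds.  Fix a Hamiltonian cycle, and let [dist x y] be the
    length of its directed segment from [x] to [y].  Suppose that edges [a b] and
    [c d] of the underlying graph cross, in the cyclic order [c, b, d, a] with
    [b != d].  The disjoint segments from [c] to [b] and from [d] to [a], joined
    by the two chords, form a cycle with two blocks whatever the orientations of
    the chords are, and the block lengths are controlled by [dist c b] and
    [dist d a] ([no_crossing]).

    Suppose that a subgraph [H] on a nonempty vertex set [S] has minimum degree at
    least [k + l].  Let [c] be the element of [S] that comes next after [a] on the
    cycle.  A neighbour [b] of [a] is far from [a] when [l <= dist c b], where
    [l - 1] suffices if [b -> a] is an arc; this is the condition on [b] in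
    [no_crossing].  Choose a pair [a, b] with [b] far from [a] and [dist a b]
    minimal, and let [y] be the nearest vertex far from [c].  Minimality gives
    [dist a b <= dist c y], so that [y] lies after [b] and the edges [a b] and
    [c y] cross.  This is a contradiction unless [y] is too close to [a].  Then
    counting the [k + l] neighbours of [c] leaves a single possibility
    ([nearest_far]): [y -> c] with [dist y a = k - 1], and [c -> x] for the vertex
    [x] at distance [l - 1] from [f], the element of [S] next after [c].

    In this tight case [c] is skipped: the nearest vertex [h] far from [f]
    satisfies [f -> h] because of the chord [c -> x] and is at or before [y];
    likewise [b -> a] because of the chord [y -> c], and [b] is at or after [x].
    Minimality of [dist a b] again puts [h] after [b], and the arcs [b -> a] and
    [f -> h] close a forbidden cycle ([no_dense_subgraph]).

    The bound on the chromatic number is greedy colouring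
    ([degenerate_colorable]). *)

(** * Greedy colouring *)

Lemma degenerate_colorable (d : nat) (G : sgraph) :
  degenerate d G -> colorable G d.+1.
Proof.
move=> hdeg.
have col (n : nat) (S : {set G}) : #|S| = n -> exists f : {ffun G -> 'I_d.+1},
    forall x y, x \in S -> y \in S -> edge x y -> f x != f y.
  elim: n S => [|n IHn] S cS.
    exists [ffun=> ord0] => x y; by rewrite (cards0_eq cS) inE.
  pose H : rel G := fun x y => [&& x \in S, y \in S & edge x y].
  have subH : is_subgraph S H.
    by split=> [x y|x y //]; rewrite /H edge_sym andbCA.
  have S0 : S != set0 by rewrite -card_gt0 cS.
  have [v vS degv] := hdeg S H subH S0.
  have cS' : #|S :\ v| = n by have := cardsD1 v S; rewrite vS cS => -[].
  have [f fP] := IHn _ cS'.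
  have [i iP] : exists i, i \notin f @: [set w | H v w].
    apply/existsP; rewrite -negb_forall; apply/negP => /forallP all_used.
    have : #|f @: [set w | H v w]| < #|'I_d.+1|.
      by rewrite card_ord ltnS (leq_trans (leq_imset_card _ _)).
    by rewrite (eq_card (_ : _ =i predT)) ?ltnn // => j; rewrite all_used.
  have newcol w : w \in S -> edge v w -> i != f w.
    move=> wS evw; apply: contraNneq iP => ->; apply: imset_f.
    by rewrite inE /H vS wS.
  exists [ffun x => if x == v then i else f x] => x y xS yS exy; rewrite !ffunE.
  case: (eqVneq x v) exy => [->|xv] exy; case: (eqVneq y v) exy => [->|yv] exy.
  - by rewrite edge_irr in exy.
  - exact: newcol.
  - by rewrite eq_sym newcol // edge_sym.
  - by apply: fP; rewrite // !inE ?xv ?yv.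
have [f fP] := col _ [set: G] erefl.
by apply/existsP; exists f; apply/forallP=> x; apply/forallP=> y;
   apply/implyP; apply: fP.
Qed.

(** * Two disjoint paths joined by two arcs *)

Section Chords.
Variables (D : digraph) (k l : nat).
Implicit Types (a b c d : D) (p q : seq D).

Lemma has_two_block_cycleC :
  has_two_block_cycle D k l -> has_two_block_cycle D l k.
Proof.
case=> x [y [p [q [[xp xq] dpq kp lq pq0]]]].
by exists x, y, q, p; split; rewrite 1?disjoint_sym 1?addnC.
Qed.

(** The tails [c] and [last d q] lie in different paths, one being an initial and
    the other a final vertex.  The blocks go from [c] to [last c p]: one is
    [c :: p] itself, and the other makes a detour through the whole of [d :: q]. *)
Lemma detour_two_block_cycle c d p q :
  path (@arc D) c p -> path (@arc D) d q -> uniq (c :: p ++ d :: q) ->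
  arc c d -> arc (last d q) (last c p) ->
  0 < l -> k <= (size q).+2 -> l <= size p -> has_two_block_cycle D k l.
Proof.
move=> cp dq; case/lastP: p cp => [|p b] cp; first by case: l.
rewrite last_rcons size_rcons => upq cd ab _ kq lp.
have upq' : uniq ((c :: rcons (d :: q) b) ++ p).
  rewrite -(perm_uniq (s1 := c :: rcons p b ++ d :: q)) //.
  by apply/permP=> P; rewrite -!cats1 /= !count_cat /= ?count_cat /=; lia.
exists c, b, (d :: q), p; split=> //.
  split; rewrite /dipath.
    by rewrite rcons_path /= cd dq ab; move: upq'; rewrite cat_uniq => /andP[].
  by rewrite cp; move: upq; rewrite -cat_cons cat_uniq => /andP[].
move: upq'; rewrite cat_uniq disjoint_sym disjoint_has => /and3P[_ /hasPn hp _].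
apply/hasPn=> z zp; apply: contra (hp z zp) => zq.
by rewrite inE mem_rcons inE; apply/or3P/Or33.
Qed.

(** The two arcs go from [d :: q] to [c :: p], one joining their
    starts and the other their ends.  The blocks go from [d] to [last c p], and
    each traverses one of the two paths and one of the two arcs.  If [p] and [q]
    are both empty, then the two blocks coincide; [3 <= k + l] excludes this. *)
Lemma parallel_two_block_cycle c d p q :
  path (@arc D) c p -> path (@arc D) d q -> uniq (c :: p ++ d :: q) ->
  arc d c -> arc (last d q) (last c p) ->
  3 <= k + l -> k <= (size q).+1 -> l <= (size p).+1 ->
  has_two_block_cycle D k l.
Proof.
move=> cp dq; rewrite -cat_cons => upq dc ab kl kq lp.
case/lastP E: {1}(c :: p) => [//|p' b].
have Eb : last c p = b by rewrite -(last_cons c c p) E last_rcons.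
have Es : size p' = size p by have := congr1 size E; rewrite size_rcons => -[].
rewrite Eb in ab; rewrite E in upq.
have upq' : uniq ((d :: rcons q b) ++ p').
  rewrite -(perm_uniq (s1 := rcons p' b ++ d :: q)) //.
  by apply/permP=> P; rewrite -!cats1 /= !count_cat /= ?count_cat /=; lia.
have dqb : path (@arc D) d (rcons q b) by rewrite rcons_path dq.
exists d, b, q, p'; split; rewrite ?Es //; last by lia.
  split; rewrite /dipath.
    by rewrite dqb; move: upq'; rewrite cat_uniq => /andP[].
  rewrite -E cons_uniq /= dc cp -[_ && uniq p]/(uniq (c :: p)) andTb andbC.
  by move: upq; rewrite -E cat_uniq => /and3P[-> /norP[-> _] _].
move: upq'; rewrite cat_uniq disjoint_sym disjoint_has => /and3P[_ /hasPn hp _].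
apply/hasPn=> z zp; apply: contra (hp z zp) => zq.
by rewrite inE mem_rcons inE; apply/or3P/Or33.
Qed.

End Chords.

(** * Distances along a Hamiltonian cycle *)

Section Cycle.
Variables (D : digraph) (succ : D -> D).
Hypothesis arc_succ : forall x, arc x (succ x).
Hypothesis succ_conn : forall x y, fconnect succ x y.
Implicit Types (a b c d x y z : D).

Definition dist x y := findex succ x y.

Lemma order_succ x : order succ x = #|D|.
Proof. by rewrite /order; apply: eq_card => y; rewrite inE succ_conn. Qed.

Lemma iter_dist x y : iter (dist x y) succ x = y.
Proof. exact/iter_findex. Qed.

Lemma dist_iter x i : i < #|D| -> dist x (iter i succ x) = i.
Proof. by move=> iD; rewrite /dist findex_iter ?order_succ. Qed.

Lemma dist_lt x y : dist x y < #|D|.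
Proof. by rewrite -(order_succ x) findex_max. Qed.

Lemma dist_inj x : injective (dist x).
Proof. by move=> y z eyz; rewrite -(iter_dist x y) eyz iter_dist. Qed.

Lemma dist_gt0 x y : x != y -> 0 < dist x y.
Proof.
by rewrite lt0n; apply: contraNneq => e0; rewrite -(iter_dist x y) e0.
Qed.

(** The hypothesis says that [y] lies on the segment of the cycle from [x] to [z];
    every comparison of cyclic positions below is reduced to it. *)
Lemma dist_split x y z : dist x y <= dist x z -> dist x z = dist x y + dist y z.
Proof.
move=> le_yz; rewrite addnC; apply/eqP; rewrite -(eqn_add2r 0) !addn0.
rewrite -{2}(iter_dist x z) -(subnK le_yz) iterD iter_dist dist_iter //.
by rewrite (leq_ltn_trans (leq_subr _ _)) ?dist_lt.
Qed.

Lemma card_ball x n : #|[set y | dist x y < n]| <= n.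
Proof.
rewrite -{2}(card_ord n); case: n => [|n].
  by rewrite card_ord leqn0 cards_eq0; apply/eqP/setP=> y; rewrite !inE.
rewrite -(card_in_imset (f := fun y => inord (dist x y) : 'I_n.+1)) ?max_card //.
move=> y z; rewrite !inE => yn zn /(congr1 val); rewrite /= !inordK //.
exact: dist_inj.
Qed.

Lemma path_dist c b :
  exists p, [/\ path (@arc D) c p, last c p = b, size p = dist c b &
                c :: p = traject succ c (dist c b).+1].
Proof.
exists (traject succ (succ c) (dist c b)); split=> //.
- have := fpath_traject succ c (dist c b); apply: sub_path => x y /= /eqP <-.
  exact: arc_succ.
- by rewrite last_traject iter_dist.
- by rewrite size_traject.
Qed.

Lemma uniq_traject_succ c n : n <= #|D| -> uniq (traject succ c n).
Proof.
rewrite -(order_succ c) => nD.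
by rewrite -(take_traject succ c nD) take_uniq // -/(orbit succ c) orbit_uniq.
Qed.

Lemma disjoint_segments c b d a :
  dist c b < dist c d <= dist c a ->
  exists p q, [/\ path (@arc D) c p /\ last c p = b,
                  path (@arc D) d q /\ last d q = a,
                  size p = dist c b, size q = dist d a
                & uniq (c :: p ++ d :: q)].
Proof.
case/andP=> bd da.
have [p [cp pb sp Ep]] := path_dist c b; have [q [dq qa sq Eq]] := path_dist d a.
exists p, q; split=> //; rewrite -cat_cons Ep Eq cat_uniq.
rewrite !uniq_traject_succ ?dist_lt // andbT andTb.
apply/hasPn=> _ /trajectP[j jq ->]; apply/negP=> /trajectP[i ip].
have ca_split := dist_split da; have ca_lt := dist_lt c a.
have <- : iter (j + dist c d) succ c = iter j succ d by rewrite iterD iter_dist.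
by move/(congr1 (dist c)); rewrite !dist_iter; lia.
Qed.

(** * Crossing chords *)

Section Crossing.
Variables (k l : nat).
Hypotheses (k_gt0 : 0 < k) (l_gt0 : 0 < l) (kl_ge3 : 3 <= k + l).
Hypothesis free : ~ has_two_block_cycle D k l.

(** In the four lemmas below the cyclic order is [c, b, d, a], and each lemma
    treats one orientation of the chords.  Exchanging the two segments, and hence
    [k] and [l], reduces the last two to the first two. *)
Lemma no_chords_c_to_d_a_to_b c b d a : dist c b < dist c d <= dist c a ->
  arc c d -> arc a b -> l <= dist c b -> k <= (dist d a).+2 -> False.
Proof.
move=> /disjoint_segments[p [q [[cp <-] [dq <-] <- <- upq]]] cd ab lp kq.
by apply: free; apply: detour_two_block_cycle upq _ _ _ _ _.
Qed.

Lemma no_chords_d_to_c_a_to_b c b d a : dist c b < dist c d <= dist c a ->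
  arc d c -> arc a b -> l <= (dist c b).+1 -> k <= (dist d a).+1 -> False.
Proof.
move=> /disjoint_segments[p [q [[cp <-] [dq <-] <- <- upq]]] dc ab lp kq.
by apply: free; apply: parallel_two_block_cycle upq _ _ _ _ _.
Qed.

Lemma no_chords_d_to_c_b_to_a c b d a : dist c b < dist c d <= dist c a ->
  arc d c -> arc b a -> l <= (dist c b).+2 -> k <= dist d a -> False.
Proof.
move=> /disjoint_segments[p [q [[cp <-] [dq <-] <- <- upq]]] dc ba lp kq.
apply/free/has_two_block_cycleC; apply: (detour_two_block_cycle dq cp) => //.
by rewrite -cat_cons uniq_catC.
Qed.

Lemma no_chords_c_to_d_b_to_a c b d a : dist c b < dist c d <= dist c a ->
  arc c d -> arc b a -> l <= (dist c b).+1 -> k <= (dist d a).+1 -> False.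
Proof.
move=> /disjoint_segments[p [q [[cp <-] [dq <-] <- <- upq]]] cd ba lp kq.
apply/free/has_two_block_cycleC; apply: (parallel_two_block_cycle dq cp) => //.
  by rewrite -cat_cons uniq_catC.
by rewrite addnC.
Qed.

(** The booleans [arc b a] and [arc c d] count as numbers.  The length conditions
    of the four orientations are slightly strengthened here, so that the first
    one does not involve [d], nor the second one [b]: the two chords can then be
    chosen independently. *)
Lemma no_crossing c b d a : dist c b < dist c d <= dist c a ->
  uedge a b -> uedge c d ->
  l <= dist c b + arc b a -> k <= dist d a + arc c d -> False.
Proof.
move=> o eab ecd.
case ba: (arc b a) eab => eab; case cd: (arc c d) ecd => ecd lb kd.
- by apply: (no_chords_c_to_d_b_to_a o) => //; lia.
- apply: (no_chords_d_to_c_b_to_a o) => //; try lia.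
  by move: ecd; rewrite /uedge cd.
- apply: (no_chords_c_to_d_a_to_b o) => //; try lia.
  by move: eab; rewrite /uedge ba orbF.
- apply: (no_chords_d_to_c_a_to_b o); [move: ecd|move: eab|lia|lia];
    by rewrite /uedge ?cd ?ba ?orbF.
Qed.

(** * No subgraph of minimum degree at least k + l *)

Variables (S : {set D}) (H : rel D).
Hypothesis subH : forall x y, H x y -> [&& x \in S, y \in S & uedge x y].
Hypothesis degH : forall x, x \in S -> k + l <= #|[set y | H x y]|.

Definition follows a c :=
  [&& a \in S, c \in S, c != a &
      [forall s in S, (s != a) ==> (dist a c <= dist a s)]].

Lemma H_neq x y : H x y -> y != x.
Proof.
by case/subH/and3P=> _ _; apply: contraTneq => ->; rewrite uedge_irr.
Qed.

Lemma follows_exists a : a \in S -> exists c, follows a c.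
Proof.
move=> aS; have /card_gt0P[b] : 0 < #|[set y | H a y]|.
  by rewrite (leq_trans _ (degH aS)) // addn_gt0 k_gt0.
rewrite inE => ab; have Pb : (b \in S) && (b != a).
  by rewrite (H_neq ab); case/and3P: (subH ab) => _ ->.
case: (@arg_minnP D b (fun s => (s \in S) && (s != a)) (dist a) Pb).
move=> c /andP[cS ca] cmin.
exists c; rewrite /follows aS cS ca; apply/forall_inP=> s sS; apply/implyP=> sa.
by rewrite cmin ?sS.
Qed.

Lemma follows_le a c s : follows a c -> s \in S -> s != a -> dist a c <= dist a s.
Proof. by case/and4P=> _ _ _ /forall_inP m sS; apply/implyP/m. Qed.

Lemma follows_last a c s : follows a c -> s \in S -> dist c s <= dist c a.
Proof.
move=> ac sS; rewrite leqNgt; apply/negP=> lt_as.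
have sa : s != a by apply: contraTneq lt_as => ->; rewrite ltnn.
have := dist_split (ltnW lt_as); have := dist_split (follows_le ac sS sa).
have /and4P[_ _ ca _] := ac; rewrite eq_sym in ca; have := dist_gt0 ca.
by move: lt_as; lia.
Qed.

(** Meant for [f] following [c]: the condition that [no_crossing] puts on its
    chord [a b], with [c], [f], [y] in place of [a], [c], [b]. *)
Definition far c f y := H c y && (l <= dist f y + arc y c).

(** The neighbours of [c] that are not far lie among the [l] vertices starting at
    [f], and the far ones lie on the segment from the nearest one, [y], to [a].  If
    [y] fails the second condition of [no_crossing], this segment has at most [k]
    vertices; having [k + l] neighbours, [c] must then be adjacent to all vertices
    of both intervals, and the orientations at their ends [x] and [y] are forced
    by the failure of the two conditions. *)
Lemma nearest_far a c f : follows a c -> follows c f ->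
  exists y, far c f y /\
  (k <= dist y a + arc c y \/
   [/\ arc y c, dist y a = k.-1 &
       exists x, [/\ arc c x, H c x & dist f x = l.-1]]).
Proof.
move=> ac cf; have /and4P[cS fS _ _] := cf.
have degc := degH cS.
pose close := [set x | H c x && ~~ far c f x].
have close_ball x : x \in close -> dist f x < l.
  by rewrite inE /far => /andP[->]; rewrite -ltnNge; lia.
have card_close : #|close| <= l.
  apply: leq_trans (card_ball f l).
  by apply/subset_leq_card/subsetP=> x /close_ball; rewrite inE.
have /card_gt0P[y0] : 0 < #|[set y | far c f y]|.
  have : #|[set y | H c y]| <= #|close :|: [set y | far c f y]|.
    apply/subset_leq_card/subsetP=> x; rewrite !inE => cx.
    by rewrite cx; case: far.
  have := cardsU close [set y | far c f y].
  by move: (k_gt0); lia.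
rewrite inE => Py0; case: (@arg_minnP D y0 (far c f) (dist c) Py0) => y Py ymin.
have {y0 Py0} ya : dist c y <= dist c a.
  by case/andP: Py => /subH/and3P[_ yS _] _; apply: follows_last ac yS.
have far_ball x : far c f x -> dist y x < (dist y a).+1.
  move=> Px; have := dist_split (ymin x Px); have := dist_split ya.
  have : dist c x <= dist c a.
    by case/andP: Px => /subH/and3P[_ xS _] _; apply: follows_last ac xS.
  by lia.
have card_far : #|[set x | far c f x]| <= (dist y a).+1.
  apply: leq_trans (card_ball y _).
  by apply/subset_leq_card/subsetP=> x; rewrite !inE; apply: far_ball.
have cover : k + l <= #|close| + #|[set x | far c f x]|.
  apply: leq_trans degc _.
  apply: leq_trans (leq_card_setU _ _); apply/subset_leq_card/subsetP=> x.
  by rewrite !inE => ->; case: far.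
exists y; split=> //; case: leqP => [|topbad]; [by left|right].
have ncy : ~~ arc c y by move: topbad card_close cover card_far; lia.
have yc : arc y c.
  by case/andP: Py => /subH/and3P[_ _]; rewrite /uedge (negPf ncy).
split=> //; first by move: topbad card_close cover card_far; lia.
(* Otherwise only [l - 1] neighbours of [c] are not far, too few for [cover]. *)
have [x xclose xl] : exists2 x, x \in close & dist f x = l.-1.
  suff /card_gt0P[x] : 0 < #|close :\: [set x | dist f x < l.-1]|.
    rewrite !inE -leqNgt => /andP[fx xclose]; exists x; rewrite ?inE //.
    by have := close_ball x; rewrite inE => /(_ xclose); lia.
  have := cardsID [set x | dist f x < l.-1] close.
  have : #|close :&: [set x | dist f x < l.-1]| <= l.-1.
    by apply: leq_trans (card_ball f l.-1); apply/subset_leq_card/subsetIr.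
  by move: topbad cover card_far l_gt0; lia.
exists x; move: xclose; rewrite inE /far => /andP[cx xfar].
have nxc : ~~ arc x c by move: xfar l_gt0; rewrite cx /= xl; lia.
by split=> //; case/subH/and3P: cx => _ _; rewrite /uedge (negPf nxc) orbF.
Qed.

(** Going once around the cycle, the nearest far vertex goes around once with its
    base vertex, so somewhere it must advance, which is where chords cross.
    Choosing [a, b] with [dist a b] minimal finds such a place without winding
    numbers: a base vertex after [a] and before [b] has its nearest far
    vertex after [b]. *)
Lemma no_dense_subgraph : S = set0.
Proof.
apply/eqP/negPn/negP=> /set0Pn[a0 a0S].
have [c0 ac0] := follows_exists a0S.
have [f0 cf0] : exists f0, follows c0 f0.
  by apply: follows_exists; case/and4P: ac0.
have [y0 [Py0 _]] := nearest_far ac0 cf0.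
pose P (t : D * D * D) := follows t.1.1 t.1.2 && far t.1.1 t.1.2 t.2.
have Pt0 : P (c0, f0, y0) by rewrite /P cf0.
case: (@arg_minnP _ _ P (fun t => dist t.1.1 t.2) Pt0) => -[[a c] b] /=.
move=> /andP[/= ac Pb] tmin {a0 a0S c0 ac0 f0 cf0 y0 Py0 Pt0}.
have dmin a' c' b' : follows a' c' -> far a' c' b' -> dist a b <= dist a' b'.
  by move=> ac' Pb'; apply: (tmin (a', c', b')); rewrite /P /= ac'.
have {P tmin} [f cf] : exists f, follows c f.
  by apply: follows_exists; case/and4P: ac.
have [g fg] : exists g, follows f g.
  by apply: follows_exists; case/and4P: cf.
have inS x y : H x y -> y \in S by case/subH/and3P.
have adj x y : H x y -> uedge x y by case/subH/and3P.
have [y [Py ytop]] := nearest_far ac cf.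
have [h [Ph htop]] := nearest_far cf fg.
have /andP[Hab bl] := Pb; have /andP[Hcy yl] := Py; have /andP[Hfh hl] := Ph.
have dab := dist_split (follows_le ac (inS _ _ Hab) (H_neq Hab)).
have dcy := dist_split (follows_le cf (inS _ _ Hcy) (H_neq Hcy)).
have dfh := dist_split (follows_le fg (inS _ _ Hfh) (H_neq Hfh)).
have /and4P[_ _ ca _] := ac; rewrite eq_sym in ca; have ac_gt0 := dist_gt0 ca.
have /and4P[_ _ fc _] := cf; rewrite eq_sym in fc; have cf_gt0 := dist_gt0 fc.
have /and4P[_ _ gf _] := fg; rewrite eq_sym in gf; have fg_gt0 := dist_gt0 gf.
have ya := follows_last ac (inS _ _ Hcy).
have hc := follows_last cf (inS _ _ Hfh).
have le_ab_cy := dmin _ _ _ cf Py; have le_ab_fh := dmin _ _ _ fg Ph.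
have lt_by : dist c b < dist c y by move: le_ab_cy dab ac_gt0; clear; lia.
case: ytop => [ytop|[yc yak [x [cx Hcx fx]]]].
  by apply: (@no_crossing c b y a); rewrite ?lt_by ?adj.
have dcx := dist_split (follows_le cf (inS _ _ Hcx) (H_neq Hcx)).
have xa := follows_last ac (inS _ _ Hcx).
have dya := dist_split ya; have dxa := dist_split xa.
have k1hc : k.-1 <= dist h c.
  by case: htop => [|[_ ->]] //; case: (arc f h); clear; lia.
have lt_xh : dist f x < dist f h.
  by move: dfh hl fx l_gt0 fg_gt0; case: (arc h f); clear; lia.
(* The arcs [h -> f] and [c -> x] would give blocks from [h] to [x]. *)
have hf : ~~ arc h f.
  apply/negP => hf; apply: (@no_chords_d_to_c_a_to_b f x h c) => //.
  - by rewrite lt_xh.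
  - by move: fx; clear; lia.
  - by move: k1hc; clear; lia.
have fh : arc f h by have := adj _ _ Hfh; rewrite /uedge (negPf hf) orbF.
have ktop : k <= dist h c + arc f h by move: k1hc; rewrite fh; clear; lia.
(* Otherwise the chords [c y] and [f h] cross. *)
have hy : dist f h <= dist f y.
  rewrite leqNgt; apply/negP=> lt_yh.
  by apply: (@no_crossing f y h c); rewrite ?lt_yh ?adj.
(* Otherwise the chords [a b] and [c x] cross: [x] is at or before [y], and as
   [c -> x] it satisfies the condition that [y] may fail. *)
have xb : dist c x <= dist c b.
  rewrite leqNgt; apply/negP=> lt_bx.
  apply: (@no_crossing c b x a); rewrite ?lt_bx ?adj //.
  rewrite cx; move: dcx dcy dxa dya fx yl yak; case: (arc y c); clear; lia.
have dcb : dist c b = dist c f + dist f b.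
  by apply: dist_split; move: xb dcx; clear; lia.
have dfa : dist c a = dist c f + dist f a.
  by apply: dist_split; apply: follows_le cf _ _ => //; case/and4P: ac.
have hc_neq : h != c.
  apply: contraNneq (H_neq Hcy) => hc_eq; apply/eqP/(@dist_inj f).
  by apply/eqP; rewrite eqn_leq -{2}hc_eq hy (follows_last cf) ?(inS _ _ Hcy).
have dch := dist_split (follows_le cf (inS _ _ Hfh) hc_neq).
have dha : dist c a = dist c h + dist h a.
  by apply: dist_split; move: dch dcy hy ya; clear; lia.
(* The arcs [a -> b] and [y -> c] would give blocks from [y] to [b]. *)
have ba : arc b a.
  apply: contraT => nba; have := adj _ _ Hab.
  rewrite /uedge (negPf nba) orbF => ab.
  case: (@no_chords_d_to_c_a_to_b c b y a) => //; first by rewrite lt_by.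
    by move: bl; rewrite (negPf nba); clear; lia.
  by rewrite yak; clear; lia.
(* The cyclic order is [a, c, f, b, h], with [h] at or before [y]; the blocks go
   from [f] to [a]. *)
apply: (@no_chords_c_to_d_b_to_a f b h a) => //.
- by move: le_ab_fh dab dcb dch dfa dha ac_gt0 cf_gt0; clear; lia.
- by move: dcb dcx xb fx; clear; lia.
- by move: dha dya dch dcy hy yak; clear; lia.
Qed.
End Crossing.
End Cycle.

Theorem theorem1p5 (k l : nat) (D : digraph)
  (hk : 0 < k) (hl : 0 < l) (hkl : 3 <= k + l)
  (hD : hamiltonian D) (hfree : ~ has_two_block_cycle D k l) :
  degenerate (k + l - 1) (underlying D) /\
  chromatic_number (underlying D) <= k + l.
Proof.
have deg : degenerate (k + l - 1) (underlying D).
  have [C [_ /andP[cycC uniqC] memC]] := hD.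
  have arcC x : arc x (next C x) by apply: next_cycle.
  have connC x y : fconnect (next C) x y.
    by rewrite (fconnect_cycle (cycle_next uniqC) (memC x)) memC.
  move=> S H [_ subH] S0; apply/exists_inP; apply: contraNT S0.
  rewrite negb_exists_in => /forall_inP dense; apply/eqP.
  apply: (@no_dense_subgraph D (next C) arcC connC k l hk hl hkl hfree S H subH).
  by move=> x /dense; rewrite -ltnNge subn1 prednK // addn_gt0 hk.
split=> //; rewrite /chromatic_number; case: ex_minnP => n _; apply.
by have := degenerate_colorable deg; rewrite (_ : (k + l - 1).+1 = k + l) //; lia.
Qed.
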